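(* Let $T$ be a finite tree and let $e$ be an edge of $T$. Let $T^{*}$ be the tree obtained from $T$ by contracting $e$. Then $$\mu_{T}-\mu_{T^{*}}\ge\frac{1}{3},$$ with equality if and only if $T$ is a path.
   Context: All trees are finite. A subtree of a tree $T$ is a nonempty connected subgraph of $T$ (single vertices and $T$ itself are included); its order is its number of vertices. The mean subtree order (global mean) $\mu_T$ is the average order of all subtrees of $T$. Contracting an edge means deleting it and identifying its two ends, so $T^*$ is a tree with one vertex fewer than $T$. *)

(* Defs.v *)
From mathcomp Require Import all_boot all_order all_algebra.

Set Implicit Arguments.
Unset Strict Implicit.
Unset Printing Implicit Defensive.

(* A graph whose vertices are drawn from the finite type V: a set of vertices
   and a set of edges, an edge being the set of its two ends. Both components
   are data, so that subgraphs and contractions stay on the same type V and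
   the subgraphs of a graph form a finite set. *)
Definition graph (V : finType) : Type := ({set V} * {set {set V}})%type.

Section Graphs.

Variable V : finType.
Implicit Types (G H : graph V) (x y : V).

Definition vertices G : {set V} := G.1.
Definition edges G : {set {set V}} := G.2.

Definition simple_graph G : bool :=
  [forall A in edges G, (#|A| == 2) && (A \subset vertices G)].

(* When G is a simple graph, adj G x x is false since #|[set x; x]| = 1. *)
Definition adj G : rel V := fun x y => [set x; y] \in edges G.

Definition connected G : bool :=
  [forall x in vertices G, forall y in vertices G, connect (adj G) x y].

Definition acyclic G : Prop :=
  forall c : seq V, 2 < size c -> ~ ucycle (adj G) c.

Definition is_tree G : Prop :=
  [/\ simple_graph G, vertices G != set0, connected G & acyclic G].

Definition is_path G : Prop :=
  exists x (p : seq V),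
    [/\ uniq (x :: p), vertices G = [set:: x :: p]
      & edges G = [set:: pairmap (fun a b => [set a; b]) x p]].

Definition subgraph H G : bool :=
  [&& simple_graph H, vertices H \subset vertices G & edges H \subset edges G].

Definition subtrees G : {set graph V} :=
  [set H : graph V | [&& subgraph H G, vertices H != set0 & connected H]].

Definition mean_subtree_order G : rat :=
  ((\sum_(H in subtrees G) #|vertices H|)%N%:R / #|subtrees G|%:R)%R.

(* The merged vertex is named x. Edges form a set, so parallel edges would be
   identified; contracting an edge of a tree creates none. *)
Definition merge x y : V -> V := fun z => if z == y then x else z.

Definition contract x y G : graph V :=
  (merge x y @: vertices G,
   [set merge x y @: (A : {set V}) | A in edges G :\ [set x; y]]).

End Graphs.

(* Main.v *)
Require Import Defs.
From mathcomp Require Import all_boot all_order all_algebra.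
From mathcomp Require Import zify ring lra.

Set Implicit Arguments.
Unset Strict Implicit.
Unset Printing Implicit Defensive.

Import Order.TTheory GRing.Theory Num.Theory.

(** Removing the edge xy from the tree T leaves a tree A containing x and a
    tree B containing y.  For A rooted at x let a and p be the number and the
    total order of the subtrees through the root, and N and W the number and
    the total order of all subtrees; let b, q, M, U be the same data for B
    rooted at y.  A subtree of T lies in A, or lies in B, or is the union of a
    subtree of A through x and a subtree of B through y, and the subtrees of
    the contracted tree correspond to the subtrees of T that contain both of x
    and y or none of them.  So both means are rational functions of the eight
    numbers, and after clearing positive denominators the difference minus 1/3
    becomes
      g = n (3 (ab + p + q) - (N + M + ab)) - 3 (a + b) w,
    where n = N + M - a - b + ab and w = W + U - p - q + pb + qa - ab are the
    number and the total order of the subtrees of the contracted tree.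

    Three inequalities about one rooted tree make g nonnegative:
      a <= N <= p,
      pathgap = N + a^2 + a - 3p >= 0,
      meangap = N (3p - N + 2a + 2) - 3 (a + 1) W >= 0.
    The last one is the theorem itself for a pendant edge attached at the
    root: it is g when B is a single vertex.  In terms of nonnegative slacks,
    (a + 1) (b + 1) g is a combination of pathgaps with nonnegative
    coefficients plus positive multiples of the two meangaps
    (contraction_gap).

    The three inequalities are proved by induction on the size of the tree: a
    rooted tree with an edge xy at its root x arises from A and B by adding a
    new root above B (profile_ext) and then gluing the result to A at the root
    (profile_merge).  Once everything is expanded in the slacks, each step is
    an identity that shows positivity.

    For equality, the induction also keeps the equivalence of meangap = 0 and
    pathgap = 0, so g = 0 means that both pathgaps vanish.  Adding a root does
    not change pathgap, and gluing makes it positive unless one of the two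
    trees is a single vertex.  Hence pathgap vanishes exactly when the rooted
    tree is a path starting at its root (conn_rooted_profile and
    path_rooted_gap0), and g = 0 exactly when T is a path. *)

(** * Inequalities for the subtree counts of a rooted tree *)

Section Num.
Local Open Scope ring_scope.
Variable R : realFieldType.
Implicit Types a b p q N M W U : R.

(** For a path rooted at an end N = p = a (a + 1) / 2, which makes this 0. *)
Definition pathgap a p N := N + a ^+ 2 + a - 3 * p.
(** Nonnegativity is the bound W / N <= (3p - N + 2a + 2) / (3 (a + 1)) for the
    mean subtree order. *)
Definition meangap a p N W := N * (3 * p - N + 2 * a + 2) - 3 * (a + 1) * W.

(** Here a and p stand for the number and the total order of the subtrees that
    contain the root, N and W for those of all subtrees. *)
Definition profile a p N W :=
  [/\ 1 <= a, a <= N, N <= p, 0 <= pathgap a p N &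
      0 <= meangap a p N W /\ (meangap a p N W = 0 <-> pathgap a p N = 0)].

Lemma profile1 : profile 1 1 1 1.
Proof.
rewrite /profile /pathgap /meangap.
by split; [lra | lra | lra | lra | split; [lra | split; lra]].
Qed.

(** A new vertex is attached above the root and becomes the root.  A subtree
    through it is this vertex alone or with a subtree through the old root. *)
Lemma profile_ext a p N W : profile a p N W ->
  profile (a + 1) (p + a + 1) (N + a + 1) (W + p + a + 1) /\
  pathgap (a + 1) (p + a + 1) (N + a + 1) = pathgap a p N.
Proof.
move=> [a1 aN Np c0 [m0 mc]].
have eC : pathgap (a + 1) (p + a + 1) (N + a + 1) = pathgap a p N.
  by rewrite /pathgap; ring.
have eM : (a + 1) * meangap (a + 1) (p + a + 1) (N + a + 1) (W + p + a + 1) =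
    (a + 2) * meangap a p N W + (N + a + 1) * pathgap a p N.
  by rewrite /meangap /pathgap; ring.
have h1 : 0 <= (a + 2) * meangap a p N W by apply: mulr_ge0 => //; lra.
have h2 : 0 <= (N + a + 1) * pathgap a p N by apply: mulr_ge0 => //; lra.
split=> //; rewrite /profile eC; split; [lra | lra | lra | exact: c0 |].
split.
  by rewrite -(pmulr_rge0 _ (_ : 0 < a + 1)) ?eM ?addr_ge0 //; lra.
split=> [z | z].
  move: eM; rewrite z mulr0 => /esym/eqP; rewrite paddr_eq0 // => /andP[_].
  by rewrite mulf_eq0 => /orP[/eqP|/eqP //]; lra.
have n0 : a + 1 != 0 by apply: lt0r_neq0; lra.
by apply: (mulfI n0); rewrite eM z (mc.2 z) !mulr0 addr0.
Qed.

Local Ltac positivity :=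
  repeat first
    [ assumption | exact: ler01 | exact: ler0n | apply: mulr_ge0
    | apply: addr_ge0 | apply: exprn_ge0 | rewrite invr_ge0 ].

(** Two rooted trees are glued at their roots; subtrees through the common root
    are unions of subtrees through the two roots, which share one vertex.  The
    slacks X = a - 1, A = N - a, B = 3 (p - N), C = pathgap satisfy
    X (X + 1) = 2A + B + C, and Y, D, E, F satisfy the same relation.  Expanded
    in X, Y, A, C, D, F, the excess over the two meangaps has negative
    coefficients only at multiples of AC, AF, CD and DF; the relations turn
    those into multiples of B and E and cancel the negative coefficients. *)
Lemma meangap_merge a p N W b q M U :
  profile a p N W -> profile b q M U ->
  exists2 h, (a - 1) * (b - 1) <= h &
  (a + 1) * (b + 1) * meangap (a * b) (p * b + a * q - a * b)
     (N + M - a - b + a * b) (W + U - p - q + (p * b + a * q - a * b))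
  = h + (a * b + 1) * ((b + 1) * meangap a p N W + (a + 1) * meangap b q M U).
Proof.
move=> pA pB.
have [a1 aN Np C0 [m0 mc]] := pA; have [b1 bM Mq F0 [m1 mf]] := pB.
pose X := a - 1; pose Y := b - 1; pose A := N - a; pose D := M - b.
pose C := pathgap a p N; pose F := pathgap b q M.
pose B := 3 * (p - N); pose E := 3 * (q - M).
have [X0 Y0 A0 D0] : [/\ 0 <= X, 0 <= Y, 0 <= A & 0 <= D] by rewrite /X /Y /A /D; split; lra.
have [B0 E0] : 0 <= B /\ 0 <= E by rewrite /B /E; split; lra.
rewrite -/C -/F in C0 F0 mc mf *.
pose r := X * (2 + X) * (F + D * Y + D ^+ 2 * (4 + Y) + D * E)
  + Y * (2 + Y) * (C + A * X + A ^+ 2 * (4 + X) + A * B)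
  + (2 + X) * (1 + Y) * (2 + Y) * D * (2 * A + B)
  + (2 + Y) * (1 + X) * (2 + X) * A * (2 * D + E)
  + A * D * (4 * X + 4 * Y + 2 * X ^+ 2 + 2 * Y ^+ 2 + 4 * X * Y + X * Y ^+ 2
             + X ^+ 2 * Y)
  + X * Y * (3 + 6 * Y + 2 * Y ^+ 2 + 6 * X + 9 * X * Y + 3 * X * Y ^+ 2
            + 2 * X ^+ 2 + 3 * X ^+ 2 * Y + X ^+ 2 * Y ^+ 2).
have r0 : 0 <= r by rewrite /r; positivity.
(* The summand X * Y makes the excess positive when both trees are nontrivial. *)
exists (X * Y + r); first by rewrite lerDl.
by rewrite /r /meangap /B /E /A /D /C /F /X /Y /pathgap; field.
Qed.

(** Gluing two rooted trees that both have an edge creates branching or moves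
    the root away from an end, and the middle term pays for it. *)
Lemma pathgap_merge a p N W b q M U :
  profile a p N W -> profile b q M U ->
  exists2 h, 0 <= h &
  pathgap (a * b) (p * b + a * q - a * b) (N + M - a - b + a * b)
  = h + (a - 1) * (b - 1) * (a + b - 2) / 2
    + b * pathgap a p N + a * pathgap b q M.
Proof.
move=> pA pB.
have [a1 aN Np C0 [m0 mc]] := pA; have [b1 bM Mq F0 [m1 mf]] := pB.
pose X := a - 1; pose Y := b - 1; pose A := N - a; pose D := M - b.
pose C := pathgap a p N; pose F := pathgap b q M.
pose B := 3 * (p - N); pose E := 3 * (q - M).
have [X0 Y0 A0 D0] : [/\ 0 <= X, 0 <= Y, 0 <= A & 0 <= D] by rewrite /X /Y /A /D; split; lra.
have [B0 E0] : 0 <= B /\ 0 <= E by rewrite /B /E; split; lra.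
rewrite -/C -/F in C0 F0 mc mf *.
exists (Y * (C + B) / 2 + X * (F + E) / 2 + X * Y * (X * Y)).
  by positivity.
by rewrite /B /E /A /D /C /F /X /Y /pathgap; field.
Qed.

Lemma profile_unit a p N W : profile a p N W -> a = 1 -> p = 1 /\ N = 1.
Proof. by move=> [? ? ? + _] a1; rewrite /pathgap a1 => ?; split; lra. Qed.

(** The glued tree can be a path from its root only if one factor is a single
    vertex; [1 < b] says that the second one is not. *)
Lemma profile_merge a p N W b q M U :
  profile a p N W -> profile b q M U -> 1 < b ->
  profile (a * b) (p * b + a * q - a * b) (N + M - a - b + a * b)
     (W + U - p - q + (p * b + a * q - a * b)) /\
  (pathgap (a * b) (p * b + a * q - a * b) (N + M - a - b + a * b) = 0 <->
   a = 1 /\ pathgap b q M = 0).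
Proof.
move=> pA pB b_gt1.
have [a1 aN Np C0 [m0 mc]] := pA; have [b1 bM Mq F0 [m1 mf]] := pB.
have [a0 b0] : 0 <= a /\ 0 <= b by split; lra.
have [X0 Y0] : 0 <= a - 1 /\ 0 <= b - 1 by split; lra.
have [A0 D0] : 0 <= N - a /\ 0 <= M - b by split; lra.
have [B0 E0] : 0 <= p - N /\ 0 <= q - M by split; lra.
have ab2 : 0 <= a + b - 2 by lra.
have XY0 : 0 <= (a - 1) * (b - 1) by positivity.
have ab0 : 0 < (a + 1) * (b + 1) by apply: mulr_gt0; lra.
have ab1 : 0 < a * b by apply: mulr_gt0; lra.
have [hP hP0 eP] := meangap_merge pA pB; have [hC hC0 eC] := pathgap_merge pA pB.
have hP1 := le_trans XY0 hP0.
have gap : pathgap (a * b) (p * b + a * q - a * b) (N + M - a - b + a * b) = 0 <->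
   a = 1 /\ pathgap b q M = 0.
  split=> [z|[a_1 F_0]]; last first.
    have [-> ->] := profile_unit pA a_1.
    by move: F_0; rewrite /pathgap a_1; lra.
  rewrite {}z in eC.
  have h1 : 0 <= (a - 1) * (b - 1) * (a + b - 2) / 2 by positivity.
  have h2 : 0 <= b * pathgap a p N by positivity.
  have h3 : 0 <= a * pathgap b q M by positivity.
  have /eqP : a * pathgap b q M = 0 by lra.
  rewrite mulf_eq0 => /orP[/eqP|/eqP ->]; first lra.
  have /eqP : (a - 1) * (b - 1) * (a + b - 2) / 2 = 0 by lra.
  rewrite !mulf_eq0 invr_eq0 => /orP[/orP[/orP[]|]|] /eqP H;
    split=> //; clear -a1 b_gt1 H; lra.
split=> //; split.
- rewrite -subr_ge0 (_ : _ - 1 = (a - 1) * (b - 1) + (a - 1) + (b - 1)); last ring.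
  by positivity.
- lra.
- rewrite -subr_ge0 (_ : _ - _ = (p - N) * b + (q - M) * a
    + (N - a) * (b - 1) + (M - b) * (a - 1)); last ring.
  by positivity.
- by rewrite eC; positivity.
have u0 : 0 <= (b + 1) * meangap a p N W by positivity.
have v0 : 0 <= (a + 1) * meangap b q M U by positivity.
split; first by rewrite -(pmulr_rge0 _ ab0) eP; positivity.
split=> [g0|/gap[a_1 f0]].
  apply/gap; rewrite {}g0 mulr0 in eP.
  have w0 : 0 <= (a * b + 1) * ((b + 1) * meangap a p N W + (a + 1) * meangap b q M U).
    by positivity.
  have /eqP : (a - 1) * (b - 1) = 0 by lra.
  rewrite mulf_eq0 => /orP[] /eqP ?; last lra.
  split; first lra.
  have /eqP : (a * b + 1) * ((b + 1) * meangap a p N W + (a + 1) * meangap b q M U) = 0.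
    by lra.
  rewrite mulf_eq0 => /orP[/eqP|/eqP] ?; first lra.
  have /eqP : (a + 1) * meangap b q M U = 0 by lra.
  by rewrite mulf_eq0 => /orP[/eqP|/eqP/mf //]; lra.
have [p_1 N_1] := profile_unit pA a_1.
have : meangap a p N W = 0 by apply: mc.2; rewrite /pathgap a_1 p_1 N_1; ring.
have := mf.2 f0; move: f0; rewrite /meangap /pathgap a_1 p_1 N_1.
move=> f0 m q0.
rewrite (_ : _ - _ = (M * (3 * q - M + 2 * b + 2) - 3 * (b + 1) * U)
  + (b + 1) / 2 * (1 * (3 * 1 - 1 + 2 * 1 + 2) - 3 * (1 + 1) * W)); last by field.
by rewrite m q0 mulr0 addr0.
Qed.

(** The inductive step: the tree with an edge at its root is the first part
    glued to the second part extended by the root. *)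
Lemma profile_edge a p N W b q M U :
  profile a p N W -> profile b q M U ->
  profile (a * (b + 1)) (p * (b + 1) + a * q) (N + M + a * b)
     (W + U + p * b + a * q) /\
  (pathgap (a * (b + 1)) (p * (b + 1) + a * q) (N + M + a * b) = 0 <->
   a = 1 /\ pathgap b q M = 0).
Proof.
move=> pA pB.
have b1 : 1 < b + 1 by case: pB => *; lra.
have [{}pB <-] := profile_ext pB.
have := profile_merge pA pB b1.
rewrite (_ : p * (b + 1) + a * (q + b + 1) - a * (b + 1) = p * (b + 1) + a * q); last ring.
rewrite (_ : N + (M + b + 1) - a - (b + 1) + a * (b + 1) = N + M + a * b); last ring.
by rewrite (_ : W + (U + q + b + 1) - p - (q + b + 1) + (p * (b + 1) + a * q)
  = W + U + p * b + a * q); last ring.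
Qed.

(** In the slacks of [meangap_merge] the part of g outside the meangaps is a
    multiple of C plus a multiple of F.  The only negative coefficients there
    are those of CD and AF, and 2D = Y (Y + 1) - E - F and
    2A = X (X + 1) - B - C cancel them. *)
Lemma contraction_gap a p N W b q M U :
  profile a p N W -> profile b q M U ->
  let n := N + M - a - b + a * b in
  let w := W + U - p - q + (p * b + a * q - a * b) in
  let g := n * (3 * (a * b + p + q) - (N + M + a * b)) - 3 * (a + b) * w in
  0 <= g /\ (g = 0 <-> pathgap a p N = 0 /\ pathgap b q M = 0).
Proof.
move=> pA pB n w g.
have [a1 aN Np C0 [m0 mc]] := pA; have [b1 bM Mq F0 [m1 mf]] := pB.
pose X := a - 1; pose Y := b - 1; pose A := N - a; pose D := M - b.
pose C := pathgap a p N; pose F := pathgap b q M.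
pose B := 3 * (p - N); pose E := 3 * (q - M).
have [X0 Y0 A0 D0] : [/\ 0 <= X, 0 <= Y, 0 <= A & 0 <= D] by rewrite /X /Y /A /D; split; lra.
have [B0 E0] : 0 <= B /\ 0 <= E by rewrite /B /E; split; lra.
rewrite -/C -/F in C0 F0 mc mf *.
pose r := C * (Y * (2 + Y) * (2 + Y + X * (3 + Y) / 2) + A * Y * (2 + Y)
             + (2 + X) * (2 + Y) * (F + E) / 2)
  + F * (X * (2 + X) * (2 + X + Y * (3 + X) / 2) + D * X * (2 + X)
             + (2 + X) * (2 + Y) * (C + B) / 2).
have r0 : 0 <= r by rewrite /r; positivity.
have e : (a + 1) * (b + 1) * g = r + (a + b) * (b + 1) * meangap a p N W
    + (a + b) * (a + 1) * meangap b q M U.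
  by rewrite /g /n /w /r /meangap /B /E /A /D /C /F /X /Y /pathgap; field.
have [a0 b0] : 0 <= a /\ 0 <= b by split; lra.
have ab0 : 0 < (a + 1) * (b + 1) by apply: mulr_gt0; lra.
have u0 : 0 <= (a + b) * (b + 1) * meangap a p N W by positivity.
have v0 : 0 <= (a + b) * (a + 1) * meangap b q M U by positivity.
split; first by rewrite -(pmulr_rge0 _ ab0) e; positivity.
split=> [g0|[c0 f0]]; last first.
  move: e; rewrite mc.2 // mf.2 // /r c0 f0 !(mul0r, mulr0, addr0) => /eqP.
  by rewrite mulf_eq0 gt_eqF // => /eqP.
have [c0 f0] : (a + b) * (b + 1) * meangap a p N W = 0 /\
   (a + b) * (a + 1) * meangap b q M U = 0 by move: e; rewrite g0; split; lra.
by split; [apply: mc.1; move/eqP: c0 | apply: mf.1; move/eqP: f0];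
  rewrite !mulf_eq0 => /orP[/orP[]|] /eqP // ?; lra.
Qed.
End Num.

(** * Connected sets and bridges *)

Section Conn.
Variables (V : finType) (e : rel V).
Implicit Types (S X Y Z U W Q D : {set V}) (s t x y : V).

(** Connectedness is stated through closed subsets rather than walks, because
    cutting and gluing connected sets along an edge then needs no surgery on
    walks. *)
Definition conn S : bool :=
  (S != set0) && [forall X : {set V},
    [&& X \subset S, X != set0 & [forall a in X, forall b in S, e a b ==> (b \in X)]]
    ==> (X == S)].

Lemma connP S :
  reflect (S != set0 /\ forall X, X \subset S -> X != set0 ->
             (forall a b, a \in X -> b \in S -> e a b -> b \in X) -> X = S)
          (conn S).
Proof.
apply: (iffP andP) => -[S0 h]; split=> //.
  move=> X XS X0 clX; apply/eqP/(implyP (forallP h X)); rewrite XS X0 /=.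
  by apply/forall_inP => a aX; apply/forall_inP => b bS; apply/implyP/clX.
apply/forallP => X; apply/implyP => /and3P[XS X0 clX].
apply/eqP/h => // a b aX bS.
by move/forall_inP: clX => /(_ a aX)/forall_inP/(_ b bS)/implyP.
Qed.

Lemma conn1 x : conn [set x].
Proof.
apply/connP; split=> [|X]; first by apply/set0Pn; exists x; rewrite inE.
by rewrite subset1 => /orP[/eqP -> //|/eqP ->]; rewrite eqxx.
Qed.

Lemma conn_neighbour S x : conn S -> x \in S -> S != [set x] ->
  exists2 y, y \in S & (y != x) && e x y.
Proof.
move=> /connP[_ cS] xS Sx.
case: (pickP [pred y | (y \in S) && ((y != x) && e x y)]) => [y /= /andP[yS h]|none].
  by exists y.
case/eqP: Sx; apply/esym/cS; rewrite ?sub1set //.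
  by apply/set0Pn; exists x; rewrite inE.
move=> a b /set1P-> bS eab; rewrite inE; apply/negPn/negP => bx.
by have := none b; rewrite /= bS bx eab.
Qed.

(** Z is one side of the partition left by deleting the edge st. *)
Definition cut s t Z :=
  [/\ s \in Z, t \notin Z &
      forall a b, a \in Z -> b \notin Z -> e a b -> a = s /\ b = t].

(** A graph has no cycle when each of its edges is a bridge. *)
Definition forest := forall s t, e s t -> exists Z, cut s t Z.

Definition connsets D : {set {set V}} := [set S | conn S & S \subset D].

Hypothesis e_sym : symmetric e.

Lemma cutC s t Z : cut s t Z -> cut t s (~: Z).
Proof.
move=> [sZ tZ h]; split; rewrite ?inE ?negbK // => a b.
by rewrite !inE negbK => aZ bZ; rewrite e_sym => /(h b a bZ aZ)[].
Qed.

Section Cut.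
Variables (s t : V) (Z : {set V}).
Hypothesis cutZ : cut s t Z.

Lemma conn_cut_meet S a b : conn S -> a \in S -> b \in S -> a \in Z -> b \notin Z ->
  s \in S /\ t \in S.
Proof.
have [sZ tZ h] := cutZ; move=> /connP[_ cS] aS bS aZ bZ.
apply/andP; apply: contraR bZ => st.
have SZ : S :&: Z = S.
  apply: cS; first exact: subsetIl.
    by apply/set0Pn; exists a; rewrite inE aS.
  move=> u v; rewrite !inE => /andP[uS uZ] vS euv; rewrite vS /=.
  apply: contraR st => vZ; have [<- <-] := h u v uZ vZ euv.
  by rewrite uS.
by move: bS; rewrite -SZ inE => /andP[].
Qed.

(** A nonempty closed part X of the restriction that contains s becomes closed
    in S when the other side of the cut is added; one that misses s is already
    closed in S, as the cut can only be crossed at s. *)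
Lemma conn_cut_restrict S : conn S -> s \in S -> t \in S -> conn (S :&: Z).
Proof.
have [sZ tZ h] := cutZ; move=> /connP[_ cS] sS tS.
apply/connP; split=> [|X XSZ X0 clX]; first by apply/set0Pn; exists s; rewrite inE sS.
have [XS XZ] : X \subset S /\ X \subset Z by apply/andP; rewrite -subsetI.
have [sX|sX] := boolP (s \in X).
  have E : X :|: S :\: Z = S.
    apply: cS.
    - by rewrite subUset XS subsetDl.
    - by apply/set0Pn; exists s; rewrite inE sX.
    - move=> a b; rewrite !inE => aX bS eab; rewrite bS andbT.
      have [bZ|//] := boolP (b \in Z); rewrite /= ?orbF ?orbT //.
      case/orP: aX => [aX|/andP[aZ aS]]; first by apply: clX eab; rewrite // inE bS.
      by rewrite e_sym in eab; have [-> _] := h b a bZ aZ eab.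
  apply/eqP; rewrite eqEsubset XSZ /=; apply/subsetP => z; rewrite inE => /andP[zS zZ].
  by move: zS; rewrite -{1}E !inE zZ orbF.
have E : X = S.
  apply: cS => // a b aX bS eab.
  have [bZ|bZ] := boolP (b \in Z); first by apply: clX eab; rewrite // inE bS.
  have [as_ _] := h a b (subsetP XZ _ aX) bZ eab.
  by rewrite as_ (negbTE sX) in aX.
by rewrite E sS in sX.
Qed.

End Cut.

Section Edge.
Variables (s t : V) (Z : {set V}).
Hypotheses (cutZ : cut s t Z) (est : e s t).

Lemma conn_cut_restrict_compl S : conn S -> s \in S -> t \in S -> conn (S :\: Z).
Proof.
by move=> cS sS tS; rewrite setDE; apply: conn_cut_restrict (cutC cutZ) _ cS tS sS.
Qed.

Lemma conn_cut_union U W : conn U -> conn W -> s \in U -> t \in W -> conn (U :|: W).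
Proof.
move=> /connP[_ cU] /connP[_ cW] sU tW.
apply/connP; split=> [|X XUW X0 clX]; first by apply/set0Pn; exists s; rewrite inE sU.
have side Y z : Y \subset U :|: W -> (forall Q, Q \subset Y -> Q != set0 ->
     (forall a b, a \in Q -> b \in Y -> e a b -> b \in Q) -> Q = Y) ->
     z \in X -> z \in Y -> Y \subset X.
  move=> YUW cY zX zY; apply/setIidPr; apply: cY => //; first exact: subsetIr.
    by apply/set0Pn; exists z; rewrite inE zX.
  move=> a b; rewrite !inE => /andP[aX aY] bY eab; rewrite bY andbT.
  by apply: clX eab => //; apply: (subsetP YUW).
have sideU z := side U z (subsetUl _ _) cU.
have sideW z := side W z (subsetUr _ _) cW.
have sUW : s \in U :|: W by rewrite inE sU.
have tUW : t \in U :|: W by rewrite inE tW orbT.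
have st : s \in X -> t \in X by move=> sX; apply: clX est.
have ts : t \in X -> s \in X by move=> tX; apply: (clX t); rewrite // e_sym.
apply/eqP; rewrite eqEsubset XUW /= subUset.
have [z zX] := set0Pn _ X0.
have : z \in U :|: W by apply: (subsetP XUW).
rewrite inE => /orP[zU|zW].
  have UX := sideU z zX zU; rewrite UX /=; apply: (sideW t) => //.
  by apply/st/(subsetP UX).
have WX := sideW z zX zW; rewrite WX andbT; apply: (sideU s) => //.
by apply/ts/(subsetP WX).
Qed.

(** The connected sets that meet both sides of the cut are in bijection with
    the pairs of a connected set through s and a connected set through t. *)
Lemma connsets_sum D (f : {set V} -> nat) :
  s \in D -> t \in D ->
  \sum_(S in connsets D) f S =
    \sum_(S in connsets (D :&: Z)) f S + \sum_(S in connsets (D :\: Z)) f S +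
    \sum_(U in connsets (D :&: Z) | s \in U)
       \sum_(W in connsets (D :\: Z) | t \in W) f (U :|: W).
Proof.
move=> sD tD; have [sZ tZ h] := cutZ.
rewrite (bigID (fun S => S \subset Z)) /= -addnA; congr (_ + _).
  by apply: eq_bigl => S; rewrite !inE subsetI andbA.
rewrite (bigID (fun S => [disjoint S & Z])) /=; congr (_ + _).
  apply: eq_bigl => S; rewrite !inE subsetD.
  have [/connP[/set0Pn[z zS] _]|] //= := boolP (conn S).
  have [dis|] := boolP [disjoint S & Z]; rewrite ?andbF ?andbT //.
  rewrite andb_idr // => _; apply/negP => /subsetP/(_ z zS).
  by rewrite (disjointFr dis zS).
rewrite pair_big_dep /=.
rewrite (reindex_onto (fun p : {set V} * {set V} => p.1 :|: p.2)
                      (fun S => (S :&: Z, S :\: Z))) /=; last first.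
  by move=> S _; rewrite setID.
apply: eq_bigl => -[U W] /=; rewrite xpair_eqE.
apply/idP/idP.
  case/andP => /andP[/andP[]]; rewrite inE => /andP[cS SD] SnZ SdZ /andP[/eqP EU /eqP EW].
  have [a aS aZ] := subsetPn SnZ.
  have [b bS bZ] : exists2 b, b \in U :|: W & b \in Z.
    by case/pred0Pn: SdZ => b /andP[]; exists b.
  have [sS tS] := conn_cut_meet cutZ cS bS aS bZ aZ.
  have := conn_cut_restrict cutZ cS sS tS; rewrite EU => cU.
  have := conn_cut_restrict_compl cS sS tS; rewrite EW => cW.
  have -> : U \in connsets (D :&: Z) by rewrite inE cU -{1}EU setSI.
  have -> : W \in connsets (D :\: Z) by rewrite inE cW -{1}EW setSD.
  have -> : s \in U by rewrite -EU in_setI sS.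
  by have -> : t \in W by rewrite -EW in_setD tZ.
case/andP => /andP[Uf sU] /andP[Wf tW].
move: Uf Wf; rewrite !in_set subsetI subsetD => /and3P[cU UD UZ] /and3P[cW WD WZ].
rewrite (conn_cut_union cU cW sU tW) subUset UD WD /= setIUl setDUl.
rewrite (setIidPl UZ) (disjoint_setI0 WZ) setU0.
have -> : U :\: Z = set0 by apply/eqP; rewrite setD_eq0.
rewrite set0U (setDidPl WZ) !eqxx !andbT subUset negb_and; apply/andP; split.
  by apply/orP; right; apply/subsetPn; exists t.
by apply/pred0Pn; exists s; rewrite /= !inE sU sZ.
Qed.
End Edge.
End Conn.

(** * Counting connected sets *)

Section Count.
Variables (V : finType) (e : rel V).
Implicit Types (S X Y Z U W Q D : {set V}) (s t x y : V).
Notation connsets := (connsets e).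
Notation cut := (cut e).

Definition num_conn D := \sum_(S in connsets D) 1.
Definition tot_conn D := \sum_(S in connsets D) #|S|.
Definition num_rooted D x := \sum_(S in connsets D | x \in S) 1.
Definition tot_rooted D x := \sum_(S in connsets D | x \in S) #|S|.
(** A set that contains both of x and y or none of them stands for its image in
    the contracted graph, whose size is that of the set without y. *)
Definition num_compatible D x y := \sum_(S in connsets D | (x \in S) == (y \in S)) 1.
Definition tot_compatible D x y :=
  \sum_(S in connsets D | (x \in S) == (y \in S)) #|S :\ y|.

Hypothesis e_sym : symmetric e.
Variables (s t : V) (Z D : {set V}).
Hypotheses (cutZ : cut s t Z) (est : e s t) (sD : s \in D) (tD : t \in D).
Let A := D :&: Z.
Let B := D :\: Z.

Lemma connsets_mem U x : U \in connsets A -> x \notin Z -> x \in U = false.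
Proof.
rewrite !inE subsetI => /and3P[_ _ UZ] xZ; apply: contraNF xZ; exact: subsetP.
Qed.

Lemma connsets_memC W x : W \in connsets B -> x \in Z -> x \in W = false.
Proof.
rewrite !inE subsetD => /and3P[_ _ WZ] xZ; exact: disjointFl WZ xZ.
Qed.

Lemma connsets_cond_sum (P : pred {set V}) (f : {set V} -> nat) :
  \sum_(S in connsets D | P S) f S =
    \sum_(S in connsets A | P S) f S + \sum_(S in connsets B | P S) f S +
    \sum_(U in connsets A | s \in U)
       \sum_(W in connsets B | t \in W) if P (U :|: W) then f (U :|: W) else 0.
Proof.
rewrite big_mkcondr (connsets_sum e_sym cutZ est _ sD tD).
by congr (_ + _ + _); rewrite big_mkcondr.
Qed.

Lemma pair_sum1 :
  \sum_(U in connsets A | s \in U) \sum_(W in connsets B | t \in W) 1 =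
  num_rooted A s * num_rooted B t.
Proof. by rewrite big_distrl /=; apply: eq_bigr => U _; rewrite mul1n. Qed.

Lemma pair_sum_card :
  \sum_(U in connsets A | s \in U) \sum_(W in connsets B | t \in W) #|U :|: W| =
  tot_rooted A s * num_rooted B t + num_rooted A s * tot_rooted B t.
Proof.
rewrite !big_distrl -big_split /=; apply: eq_bigr => U /andP[UA sU].
rewrite mul1n big_distrr -big_split /=; apply: eq_bigr => W /andP[WB tW].
rewrite cardsU (_ : U :&: W = set0) ?cards0 ?subn0 ?muln1 //.
apply/setP=> z; rewrite !inE; have [zU|//] := boolP (z \in U) => /=.
apply: connsets_memC WB _; apply: contraTT zU => zZ.
by rewrite (connsets_mem UA zZ).
Qed.

Lemma num_conn_edge : num_conn D = num_conn A + num_conn B + num_rooted A s * num_rooted B t.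
Proof. by rewrite -pair_sum1 -connsets_sum. Qed.

Lemma tot_conn_edge :
  tot_conn D = tot_conn A + tot_conn B +
    (tot_rooted A s * num_rooted B t + num_rooted A s * tot_rooted B t).
Proof. by rewrite -pair_sum_card -connsets_sum. Qed.

Let sZ : s \in Z. Proof. by case: cutZ. Qed.
Let tZ : t \notin Z. Proof. by case: cutZ. Qed.

Lemma rooted_sum (f : {set V} -> nat) :
  \sum_(S in connsets D | s \in S) f S =
    \sum_(S in connsets A | s \in S) f S +
    \sum_(U in connsets A | s \in U) \sum_(W in connsets B | t \in W) f (U :|: W).
Proof.
rewrite connsets_cond_sum -addnA; congr (_ + _); rewrite big1 ?add0n; last first.
  by move=> W /andP[WB]; rewrite (connsets_memC WB sZ).
by apply: eq_bigr => U /andP[_ sU]; apply: eq_bigr => W _; rewrite inE sU.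
Qed.

Lemma num_rooted_edge : num_rooted D s = num_rooted A s * (num_rooted B t + 1).
Proof. by rewrite /num_rooted rooted_sum pair_sum1 mulnDr muln1 addnC. Qed.

Lemma tot_rooted_edge :
  tot_rooted D s = tot_rooted A s * (num_rooted B t + 1) + num_rooted A s * tot_rooted B t.
Proof. by rewrite {1}/tot_rooted rooted_sum pair_sum_card mulnDr muln1 addnA (addnC (_ * _)). Qed.

(** A set inside one side of the cut misses one end of the edge, so it must
    miss the other one too. *)
Lemma compatible_sum (f : {set V} -> nat) :
  \sum_(S in connsets D | (s \in S) == (t \in S)) f S =
    \sum_(S in connsets A | s \notin S) f S + \sum_(S in connsets B | t \notin S) f S +
    \sum_(U in connsets A | s \in U) \sum_(W in connsets B | t \in W) f (U :|: W).
Proof.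
rewrite connsets_cond_sum; congr (_ + _ + _).
- apply: eq_bigl => U; apply: andb_id2l => UA.
  by rewrite (connsets_mem UA tZ) eqbF_neg.
- apply: eq_bigl => W; apply: andb_id2l => WB.
  by rewrite (connsets_memC WB sZ) eq_sym eqbF_neg.
apply: eq_bigr => U /andP[_ sU]; apply: eq_bigr => W /andP[_ tW].
by rewrite !inE sU tW orbT.
Qed.

Lemma sum_by_membership Y x (f : {set V} -> nat) :
  \sum_(S in connsets Y) f S =
  \sum_(S in connsets Y | x \notin S) f S + \sum_(S in connsets Y | x \in S) f S.
Proof. by rewrite (bigID (fun S => x \in S)) addnC. Qed.

Lemma num_compatible_edge :
  num_compatible D s t + num_rooted A s + num_rooted B t =
  num_conn A + num_conn B + num_rooted A s * num_rooted B t.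
Proof.
rewrite /num_compatible compatible_sum pair_sum1 /num_conn.
rewrite (sum_by_membership A s) (sum_by_membership B t).
rewrite -!/(num_rooted _ _); lia.
Qed.

Lemma tot_compatible_edge :
  tot_compatible D s t + tot_rooted A s + tot_rooted B t + num_rooted A s * num_rooted B t =
  tot_conn A + tot_conn B + (tot_rooted A s * num_rooted B t + num_rooted A s * tot_rooted B t).
Proof.
rewrite -pair_sum1 -pair_sum_card /tot_compatible compatible_sum.
rewrite /tot_conn (sum_by_membership A s) (sum_by_membership B t).
rewrite -!/(tot_rooted _ _).
have D1 S : t \notin S -> #|S :\ t| = #|S|.
  by move=> tS; rewrite [RHS](cardsD1 t) (negbTE tS).
have -> : \sum_(S in connsets A | s \notin S) #|S :\ t| = \sum_(S in connsets A | s \notin S) #|S|.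
  by apply: eq_bigr => U /andP[UA _]; rewrite D1 // (connsets_mem UA tZ).
have -> : \sum_(S in connsets B | t \notin S) #|S :\ t| = \sum_(S in connsets B | t \notin S) #|S|.
  by apply: eq_bigr => U /andP[UA tU]; rewrite D1.
have <- : \sum_(U in connsets A | s \in U) \sum_(W in connsets B | t \in W) #|(U :|: W) :\ t| +
  \sum_(U in connsets A | s \in U) \sum_(W in connsets B | t \in W) 1 =
  \sum_(U in connsets A | s \in U) \sum_(W in connsets B | t \in W) #|U :|: W|.
  rewrite -big_split; apply: eq_bigr => U _; rewrite -big_split; apply: eq_bigr => W /andP[_ tW].
  by rewrite (cardsD1 t (U :|: W)) inE tW orbT addnC.
lia.
Qed.
End Count.

(** * Paths as lists of vertices *)

Section Links.
Variable V : finType.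
Implicit Types (l a b : seq V) (x y u v s t : V) (Z : {set V}).

Definition links l : seq {set V} :=
  if l is x :: p then pairmap (fun u v => [set u; v]) x p else [::].

Lemma links_cat a s t b :
  links (rcons a s ++ t :: b) = links (rcons a s) ++ [set s; t] :: links (t :: b).
Proof. by case: a => [|x a] //=; rewrite pairmap_cat last_rcons. Qed.

Lemma links_rev l : links (rev l) =i links l.
Proof.
elim: l => [//|x [//|y l] IH] A.
rewrite 2!rev_cons -cats1 links_cat -rev_cons mem_cat IH mem_seq1 /= in_cons.
by rewrite orbC (setUC [set y]).
Qed.

Lemma links_sub A l : A \in links l -> {subset A <= l}.
Proof.
elim: l => [//|x [//|y l] IH]; rewrite /= inE => /orP[/eqP->|/IH h] z.
  by rewrite !inE orbA => ->.
by move=> /h zl; rewrite inE zl orbT.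
Qed.

Lemma links_mem u v l : [set u; v] \in links l -> u \in l /\ v \in l.
Proof. by move/links_sub => h; split; apply: h; rewrite !inE eqxx ?orbT. Qed.

Lemma links_path x l : path (fun u v => [set u; v] \in links (x :: l)) x l.
Proof.
elim: l x => [//|y l IH] x; rewrite /= inE eqxx /=.
by apply: sub_path (IH y) => u v; rewrite /= inE orbC => ->.
Qed.

Lemma set2_cross Z u v s t : u \in Z -> v \notin Z -> s \in Z -> t \notin Z ->
  ([set u; v] == [set s; t]) = (u == s) && (v == t).
Proof.
move=> uZ vZ sZ tZ; apply/eqP/andP => [E|[/eqP-> /eqP->] //].
have : u \in [set s; t] by rewrite -E !inE eqxx.
have : v \in [set s; t] by rewrite -E !inE eqxx orbT.
rewrite !inE => /orP[/eqP vs|/eqP vt]; first by rewrite vs sZ in vZ.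
by case/orP => /eqP ut; [rewrite ut vt !eqxx | rewrite ut (negbTE tZ) in uZ].
Qed.

(** The edges inside D are exactly the links, so the subgraph induced on D is
    the path l. *)
Definition spans_path (e : rel V) l (D : {set V}) :=
  [/\ uniq l, D = [set:: l] &
      forall u v, u \in l -> v \in l -> e u v = ([set u; v] \in links l)].

Section Glue.
Variable e : rel V.
Hypothesis e_sym : symmetric e.

(** A walk that starts at t can return to the side of s only through s. *)
Lemma path_avoids_cut s t Z b : cut e s t Z -> path e t b -> s \notin b ->
  {in t :: b, forall z, z \notin Z}.
Proof.
move=> [_ tZ h]; have {tZ} : t \notin Z := tZ.
move: {1 2 3}t => c; elim: b c => [|d b IH] c cZ /=.
  by move=> _ _ z; rewrite inE => /eqP->.
rewrite inE negb_or => /andP[ecd pdb] /andP[sd sb] z.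
have dZ : d \notin Z.
  by apply: contra sd => dZ; rewrite e_sym in ecd; have [-> _] := h d c dZ cZ ecd.
by rewrite inE => /orP[/eqP-> //|]; apply: IH.
Qed.

Variables (s t : V) (Z D : {set V}) (a b : seq V).
Hypothesis cutZ : cut e s t Z.

Let mem_links A : A \in links (rev (s :: a) ++ t :: b) =
  [|| A \in links (s :: a), A == [set s; t] | A \in links (t :: b)].
Proof.
by rewrite rev_cons links_cat mem_cat -rev_cons links_rev inE.
Qed.

Let sZ : s \in Z. Proof. by case: cutZ. Qed.
Let tZ : t \notin Z. Proof. by case: cutZ. Qed.

Lemma crossing_edge u v : e s t -> u \in Z -> v \notin Z -> e u v = ([set u; v] == [set s; t]).
Proof.
have [_ _ h] := cutZ; move=> est uZ vZ; rewrite (set2_cross uZ vZ sZ tZ).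
by apply/idP/andP => [/(h u v uZ vZ)[-> ->] //|[/eqP-> /eqP->]].
Qed.

Let glue_links u v : e s t ->
  {in s :: a, forall z, z \in Z} -> {in t :: b, forall z, z \notin Z} ->
  u \in Z ->
  ([set u; v] \in links (rev (s :: a) ++ t :: b)) =
    if v \in Z then [set u; v] \in links (s :: a) else [set u; v] == [set s; t].
Proof.
move=> est aZ bZ uZ; rewrite mem_links.
have -> : [set u; v] \in links (t :: b) = false.
  by apply/negP => /links_mem[/bZ]; rewrite uZ.
rewrite orbF; case: ifPn => vZ.
  rewrite orb_idr // => /eqP E.
  have : t \in [set u; v] by rewrite E !inE eqxx orbT.
  by rewrite !inE => /orP[] /eqP Et; move: tZ; rewrite Et ?uZ ?vZ.
by rewrite orb_idl // => /links_mem[_ /aZ]; rewrite (negbTE vZ).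
Qed.

(** The first list is reversed because both lists start at the cut edge. *)
Lemma spans_path_glue : e s t ->
  spans_path e (s :: a) (D :&: Z) -> spans_path e (t :: b) (D :\: Z) ->
  spans_path e (rev (s :: a) ++ t :: b) D.
Proof.
move=> est [ua EA ha] [ub EB hb].
have aZ z : z \in s :: a -> z \in Z.
  by rewrite -[_ \in _ :: _](in_set (mem (s :: a))) -EA inE => /andP[].
have bZ z : z \in t :: b -> z \notin Z.
  by rewrite -[_ \in _ :: _](in_set (mem (t :: b))) -EB inE => /andP[].
split.
- rewrite cat_uniq rev_uniq ua ub andbT andTb; apply/hasPn => z /bZ.
  by apply: contra; rewrite mem_rev; apply: aZ.
- by rewrite -[LHS](setID D Z) EA EB; apply/setP => z; rewrite !inE mem_cat mem_rev.
move=> u v; rewrite !mem_cat !mem_rev.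
wlog uZ : u v / u \in Z => [th|].
  have [uZ|uZ] := boolP (u \in Z); first exact: th.
  have [vZ|vZ] := boolP (v \in Z).
    by move=> hu hv; rewrite e_sym setUC; apply: th.
  case/orP => [/aZ|ub']; first by rewrite (negbTE uZ).
  case/orP => [/aZ|vb']; first by rewrite (negbTE vZ).
  rewrite hb // mem_links.
  have -> : [set u; v] \in links (s :: a) = false.
    by apply/negP => /links_mem[/aZ]; rewrite (negbTE uZ).
  suff -> : ([set u; v] == [set s; t]) = false by [].
  apply/negP => /eqP E; have : s \in [set u; v] by rewrite E !inE eqxx.
  by rewrite !inE => /orP[] /eqP Es; move: sZ; rewrite Es ?(negbTE uZ) ?(negbTE vZ).
case/orP => [ua'|/bZ]; last by rewrite uZ.
rewrite glue_links //; case: ifPn => vZ; last by rewrite crossing_edge.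
by case/orP => [va|/bZ]; [rewrite ha | rewrite vZ].
Qed.

Lemma spans_path_unglue : e s t ->
  spans_path e (rev (s :: a) ++ t :: b) D ->
  spans_path e (s :: a) (D :&: Z) /\ spans_path e (t :: b) (D :\: Z).
Proof.
move=> est [uab ED h].
have [ua disj ub] : [/\ uniq (s :: a), {in t :: b, forall z, z \notin s :: a} & uniq (t :: b)].
  move: uab; rewrite cat_uniq rev_uniq => /and3P[-> /hasPn disj ->]; split=> // z /disj.
  by rewrite /= mem_rev.
have pa : path e s a.
  apply: sub_path (links_path s a) => u v uv; have [ul vl] := links_mem uv.
  by rewrite h ?mem_cat ?mem_rev ?ul ?vl // mem_links uv.
have pb : path e t b.
  apply: sub_path (links_path t b) => u v uv; have [ul vl] := links_mem uv.
  by rewrite h ?mem_cat ?mem_rev ?ul ?vl ?orbT // mem_links uv !orbT.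
have bZ : {in t :: b, forall z, z \notin Z}.
  apply: path_avoids_cut cutZ pb _; apply: contraL (mem_head s a) => sb.
  by apply: disj; rewrite inE sb orbT.
have aZ : {in s :: a, forall z, z \in Z}.
  have ta : t \notin a by have := disj t (mem_head _ _); rewrite inE negb_or => /andP[].
  by move=> z /(path_avoids_cut (cutC e_sym cutZ) pa ta); rewrite inE negbK.
split; split=> //.
- apply/setP => z; rewrite ED (in_setI, in_setD) !in_set mem_cat mem_rev.
  apply/andP/idP => [[/orP[//|/bZ zb] zZ]|za]; first by rewrite zZ in zb.
  by rewrite za aZ.
- move=> u v ua' va; rewrite h ?mem_cat ?mem_rev ?ua' ?va // glue_links ?aZ //.
- apply/setP => z; rewrite ED (in_setI, in_setD) !in_set mem_cat mem_rev.
  apply/andP/idP => [[zZ /orP[/aZ zb|//]]|zb]; first by rewrite zb in zZ.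
  by rewrite zb orbT bZ.
move=> u v ub' vb; rewrite h ?mem_cat ?mem_rev ?ub' ?vb ?orbT // mem_links.
have -> : [set u; v] \in links (s :: a) = false.
  by apply/negP => /links_mem[/aZ]; rewrite (negbTE (bZ u ub')).
suff -> : ([set u; v] == [set s; t]) = false by [].
apply/negP => /eqP E; have : s \in [set u; v] by rewrite E !inE eqxx.
by rewrite !inE => /orP[] /eqP Es; move: sZ; rewrite Es (negbTE (bZ _ _)).
Qed.
End Glue.
End Links.

(** * The inequalities hold for all rooted trees *)

Section Induction.
Variables (V : finType) (e : rel V).
Hypotheses (e_sym : symmetric e) (e_forest : forest e).
Implicit Types (D S Z : {set V}) (s t x y : V).

Lemma forest_irrefl x : e x x = false.
Proof. by apply/negP => /e_forest[Z [xZ /negP]]. Qed.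

Definition rooted_profile D x : Prop :=
  profile ((num_rooted e D x)%:R : rat)%R (tot_rooted e D x)%:R%R
    (num_conn e D)%:R%R (tot_conn e D)%:R%R.
Definition rooted_gap D x : rat :=
  pathgap ((num_rooted e D x)%:R : rat)%R (tot_rooted e D x)%:R%R (num_conn e D)%:R%R.

Lemma connsets1 x : connsets e [set x] = [set [set x]].
Proof.
apply/setP => S; rewrite !inE subset1; apply/andP/eqP => [[/connP[S0 _]]|->].
  by rewrite (negbTE S0) orbF => /eqP.
by rewrite eqxx conn1.
Qed.

Lemma rooted_profile1 x : rooted_profile [set x] x.
Proof.
rewrite /rooted_profile /num_rooted /tot_rooted /num_conn /tot_conn.
rewrite !big_mkcondr connsets1 !big_set1.
by rewrite inE eqxx cards1; apply: profile1.
Qed.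

Lemma rooted_gap1 x : rooted_gap [set x] x = 0%R.
Proof.
rewrite /rooted_gap /num_rooted /tot_rooted /num_conn /tot_conn.
rewrite !big_mkcondr connsets1 !big_set1.
by rewrite inE eqxx cards1 /pathgap; ring.
Qed.

Lemma rooted_profile_edge s t Z D : cut e s t Z -> e s t -> s \in D -> t \in D ->
  rooted_profile (D :&: Z) s -> rooted_profile (D :\: Z) t ->
  rooted_profile D s /\
  (rooted_gap D s = 0%R <->
   num_rooted e (D :&: Z) s = 1 /\ rooted_gap (D :\: Z) t = 0%R).
Proof.
move=> cutZ est sD tD pA pB.
have := profile_edge pA pB.
rewrite /rooted_profile /rooted_gap.
rewrite (num_conn_edge e_sym cutZ est sD tD) (tot_conn_edge e_sym cutZ est sD tD).
rewrite (num_rooted_edge e_sym cutZ est sD tD) (tot_rooted_edge e_sym cutZ est sD tD).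
rewrite !(natrD, natrM) !GRing.addrA => -[? h]; split=> //.
rewrite h; split=> -[h1 ->]; split=> //; last by rewrite h1.
by apply/eqP; rewrite -(eqr_nat rat); apply/eqP.
Qed.

(** Both D and the singleton of x are connected sets that contain x. *)
Lemma num_rooted_eq1 D x : conn e D -> x \in D -> num_rooted e D x = 1 -> D = [set x].
Proof.
move=> cD xD; apply: contra_eq => Dx; rewrite /num_rooted.
rewrite (bigD1 D) /=; last by rewrite inE cD subxx.
rewrite (bigD1 [set x]) //=.
by rewrite !inE conn1 sub1set xD eqxx eq_sym.
Qed.

Lemma conn_edge_cut D x : conn e D -> x \in D -> D != [set x] ->
  exists y Z, [/\ y \in D, e x y & cut e x y Z].
Proof.
move=> cD xD Dx; have [y yD /andP[_ exy]] := conn_neighbour cD xD Dx.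
by have [Z cutZ] := e_forest exy; exists y, Z.
Qed.

(** Induction on the size of D along any edge xy at the root.  When the gap
    vanishes the side of x is a singleton, so x is an end, and the path on the
    side of y extends to it. *)
Lemma conn_rooted_profile D x : conn e D -> x \in D ->
  rooted_profile D x /\ (rooted_gap D x = 0%R -> exists l, spans_path e (x :: l) D).
Proof.
have [n] := ubnP #|D|; elim: n D x => // n IH D x; rewrite ltnS => Dn cD xD.
have [->|Dx] := eqVneq D [set x].
  split=> [|_]; first exact: rooted_profile1.
  exists [::]; split=> //; first by apply/setP => z; rewrite !inE.
  by move=> u v; rewrite !inE => /eqP-> /eqP->; rewrite forest_irrefl.
have [y [Z [yD exy cutZ]]] := conn_edge_cut cD xD Dx.
have [xZ yZ _] := cutZ.
have cA := conn_cut_restrict e_sym cutZ cD xD yD.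
have cB := conn_cut_restrict_compl e_sym cutZ cD xD yD.
have An : #|D :&: Z| < n.
  apply: leq_trans Dn; apply: proper_card; rewrite properEneq subsetIl andbT.
  by apply: contraNneq yZ => E; move: yD; rewrite -E inE => /andP[].
have Bn : #|D :\: Z| < n.
  apply: leq_trans Dn; apply: proper_card; rewrite properEneq subsetDl andbT.
  by apply: contraTneq xZ => E; move: xD; rewrite -E inE => /andP[].
have [|pA _] := IH _ x An cA; first by rewrite inE xD.
have [|pB hB] := IH _ y Bn cB; first by rewrite inE yZ.
have [pD gD] := rooted_profile_edge cutZ exy xD yD pA pB.
split=> // /gD[a1 /hB[l lB]]; exists (y :: l).
apply: (spans_path_glue e_sym (a := [::]) cutZ exy _ lB).
rewrite (num_rooted_eq1 cA _ a1) ?inE ?xD //; split=> //; first by apply/setP => z; rewrite !inE.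
by move=> u v; rewrite !inE => /eqP-> /eqP->; rewrite forest_irrefl.
Qed.

(** Along the path every root has a single edge ahead, and the side of the root
    is a singleton. *)
Lemma path_rooted_gap0 l D x : conn e D -> spans_path e (x :: l) D -> rooted_gap D x = 0%R.
Proof.
elim: l D x => [|y l IH] D x cD hl.
  have [_ -> _] := hl; rewrite (_ : [set:: _] = [set x]) ?rooted_gap1 //.
  by apply/setP => z; rewrite !inE.
have [_ ED h] := hl.
have [xD yD] : x \in D /\ y \in D by rewrite ED !inE !eqxx orbT.
have exy : e x y by rewrite h ?inE ?eqxx ?orbT.
have [Z cutZ] := e_forest exy.
have [hA hB] := spans_path_unglue e_sym (a := [::]) cutZ exy hl.
have cA := conn_cut_restrict e_sym cutZ cD xD yD.
have cB := conn_cut_restrict_compl e_sym cutZ cD xD yD.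
have [_ EA _] := hA; have [_ EB _] := hB.
have [|pA _] := conn_rooted_profile cA (x := x); first by rewrite EA !inE eqxx.
have [|pB _] := conn_rooted_profile cB (x := y); first by rewrite EB !inE eqxx.
apply/(rooted_profile_edge cutZ exy xD yD pA pB).2; split; last exact: IH.
have -> : D :&: Z = [set x] by rewrite EA; apply/setP => z; rewrite !inE.
by rewrite /num_rooted big_mkcondr connsets1 big_set1 inE eqxx.
Qed.
End Induction.

(** * Subtrees as connected vertex sets *)

Section Graph.
Variable V : finType.
Implicit Types (G H T : graph V) (S Z : {set V}) (s t x y a b : V) (A : {set V}).

Lemma adj_sym G : symmetric (adj G).
Proof. by move=> a b; rewrite /adj setUC. Qed.

Lemma adj_vertices G a b : simple_graph G -> adj G a b ->
  [/\ a != b, a \in vertices G & b \in vertices G].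
Proof.
move=> /forall_inP sG /sG; rewrite subUset !sub1set cards2.
by case: (a != b) => //= /andP[].
Qed.

Lemma edge_adj G A : simple_graph G -> A \in edges G ->
  exists a b, A = [set a; b] /\ adj G a b.
Proof.
move=> /forall_inP sG AG; have /andP[/cards2P[a [b [_ EA]]] _] := sG A AG.
by exists a, b; rewrite /adj -EA.
Qed.

Lemma conn_mono (e1 e2 : rel V) S :
  (forall a b, a \in S -> b \in S -> e1 a b -> e2 a b) -> conn e1 S -> conn e2 S.
Proof.
move=> le12 /connP[S0 cS]; apply/connP; split=> // X XS X0 clX.
apply: cS => // a b aX bS eab; apply: (clX a) => //.
by apply: le12; rewrite // (subsetP XS).
Qed.

Lemma connected_conn G : simple_graph G -> vertices G != set0 ->
  connected G = conn (adj G) (vertices G).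
Proof.
move=> sG G0; apply/forall_inP/connP => [cG|[_ cG] a aG].
  split=> // X XG X0 clX; apply/eqP; rewrite eqEsubset XG /=.
  have [a aX] := set0Pn _ X0; apply/subsetP => b bG.
  have /forall_inP/(_ b bG) := cG a (subsetP XG a aX).
  have cl : closed (adj G) X.
    apply: intro_closed; first exact/sym_connect_sym/adj_sym.
    by move=> u v uv uX; have [_ _ vG] := adj_vertices sG uv; apply: clX uX vG uv.
  by move/(closed_connect cl) => <-.
apply/forall_inP => b bG.
have E : [set z in vertices G | connect (adj G) a z] = vertices G.
  apply: cG; first by apply/subsetP => z; rewrite inE => /andP[].
    by apply/set0Pn; exists a; rewrite inE aG connect0.
  move=> u v; rewrite !inE => /andP[_ au] -> uv.
  by apply: connect_trans au (connect1 uv).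
by move: bG; rewrite -E inE => /andP[].
Qed.

(** The side of s in the cut consists of the vertices joined to s without the
    edge st; if t were among them, a simple such walk would close up to a cycle
    through st. *)
Lemma acyclic_forest G : simple_graph G -> acyclic G -> forest (adj G).
Proof.
move=> sG acG s t st; have [nst _ _] := adj_vertices sG st.
pose r : rel V := fun u v => adj G u v && ([set u; v] != [set s; t]).
exists [set z | connect r s z].
have sZ : s \in [set z | connect r s z] by rewrite inE connect0.
have tZ : t \notin [set z | connect r s z].
  rewrite inE; apply/negP => /connectP[p0 /shortenP[p rp up _] Et].
  have adjp : path (adj G) s p by apply: sub_path rp => u v /andP[].
  apply: (acG (s :: p)); last first.
    rewrite /ucycle /= rcons_path adjp -Et adj_sym st.
    exact: up.
  case: p rp Et {up adjp} => [_ ts|c [|//]]; first by rewrite ts eqxx in nst.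
  by move=> /andP[/andP[_ /eqP sc] _] /= tc; case: sc; rewrite tc.
split=> // a b aZ bZ ab; have [/eqP|nab] := eqVneq [set a; b] [set s; t].
  by rewrite (set2_cross aZ bZ sZ tZ) => /andP[/eqP-> /eqP->].
case/negP: bZ; move: aZ; rewrite !inE => sa; apply: connect_trans sa _.
by apply: connect1; rewrite /r ab.
Qed.

Definition induced G S : graph V := (S, [set A in edges G | A \subset S]).

Lemma adj_induced G S a b : adj (induced G S) a b = [&& adj G a b, a \in S & b \in S].
Proof. by rewrite /adj inE subUset !sub1set. Qed.

(** A connected subgraph H of a forest has all the edges between its vertices:
    the cut of a missing edge would disconnect H. *)
Lemma subtrees_induced G : simple_graph G -> forest (adj G) ->
  subtrees G = [set induced G S | S in connsets (adj G) (vertices G)].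
Proof.
move=> sG fG; apply/setP => H; rewrite inE; apply/and3P/imsetP => [[]|[S]].
  move=> /and3P[sH HV HE] H0; rewrite connected_conn // => cH.
  exists (vertices H).
    rewrite inE HV andbT; apply: conn_mono cH => a b _ _.
    exact: (subsetP HE).
  case: H sH HV HE H0 cH => S E /= sH SV EG S0 cH; congr pair.
  apply/setP => A; rewrite inE; apply/idP/andP => [AE|[AG AS]].
    by split; [apply: (subsetP EG) | have /forall_inP/(_ A AE)/andP[] := sH].
  have [s [t [EA st]]] := edge_adj sG AG.
  have [Z [sZ tZ cutZ]] := fG s t st.
  apply/negPn/negP => AE; have /connP[_ cS] := cH.
  have /andP[sS tS] : (s \in S) && (t \in S) by rewrite -!sub1set -subUset -EA.
  suff SZ : S :&: Z = S by move: tS; rewrite -SZ inE (negbTE tZ) andbF.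
  apply: cS; first exact: subsetIl.
    by apply/set0Pn; exists s; rewrite inE sS.
  move=> a b; rewrite !inE => /andP[aS aZ] bS ab; rewrite bS /=.
  apply/negPn/negP => bZ; case/negP: AE; rewrite EA.
  by have [<- <-] := cutZ a b aZ bZ (subsetP EG _ ab).
rewrite inE => /andP[cS SV] ->.
have S0 : S != set0 by case/connP: cS.
have sI : simple_graph (induced G S).
  apply/forall_inP => A; rewrite inE => /andP[AG ->]; rewrite andbT.
  by have /forall_inP/(_ A AG)/andP[] := sG.
split=> //.
  by rewrite /subgraph sI SV; apply/subsetP => A; rewrite inE => /andP[].
rewrite connected_conn //; apply: conn_mono cS => a b aS bS ab.
by rewrite adj_induced ab aS.
Qed.

Lemma subtrees_sum G (f : {set V} -> nat) : simple_graph G -> forest (adj G) ->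
  \sum_(H in subtrees G) f (vertices H) =
  \sum_(S in connsets (adj G) (vertices G)) f S.
Proof.
move=> sG fG; rewrite subtrees_induced // big_imset //=.
by move=> S1 S2 _ _ [].
Qed.

Lemma mean_subtree_orderE G : simple_graph G -> forest (adj G) ->
  mean_subtree_order G =
  ((tot_conn (adj G) (vertices G))%:R / (num_conn (adj G) (vertices G))%:R)%R.
Proof.
move=> sG fG; rewrite /mean_subtree_order (subtrees_sum (fun S => #|S|)) //.
by have := subtrees_sum (fun=> 1) sG fG; rewrite sum1_card => ->.
Qed.

End Graph.

(** * Contraction of an edge *)

Section Contract.
Variables (V : finType) (T : graph V) (x y : V).
Hypotheses (sT : simple_graph T) (fT : forest (adj T)) (exy : adj T x y).
Implicit Types (S Z U X : {set V}) (s t a b u v : V).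
Let T' := contract x y T.
Let e := adj T.
Let e' := adj T'.
Let D := vertices T.
Notation m := (Defs.merge x y).

Let nxy : x != y. Proof. by have [] := adj_vertices sT exy. Qed.
Let xD : x \in D. Proof. by have [] := adj_vertices sT exy. Qed.
Let yD : y \in D. Proof. by have [] := adj_vertices sT exy. Qed.

Lemma merge_neq a : m a != y.
Proof. by rewrite /Defs.merge; case: (eqVneq a y) => // _; apply: nxy. Qed.

Lemma merge_id a : a != y -> m a = a.
Proof. by rewrite /Defs.merge => /negbTE->. Qed.

Lemma merge_y : m y = x.
Proof. by rewrite /Defs.merge eqxx. Qed.

Lemma vertices_contract : vertices T' = D :\ y.
Proof.
apply/setP => z; rewrite !inE; apply/imsetP/andP => [[a aD ->]|[zy zD]].
  by split; [exact: merge_neq | rewrite /Defs.merge; case: ifP].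
by exists z; rewrite ?merge_id.
Qed.

Lemma merge_set2 a b : m @: [set a; b] = [set m a; m b].
Proof. by rewrite imsetU !imset_set1. Qed.

Lemma adj_contractP u v :
  reflect (exists a b, [/\ e a b, [set a; b] != [set x; y], m a = u & m b = v]) (e' u v).
Proof.
apply: (iffP imsetP) => [[A /setD1P[nA AT] E]|[a [b [ab nab <- <-]]]]; last first.
  by exists [set a; b]; rewrite ?merge_set2 // !inE nab.
have [a [b [EA ab]]] := edge_adj sT AT.
move: E; rewrite EA merge_set2 => E; rewrite EA in nA.
have : m a \in [set u; v] by rewrite E !inE eqxx.
have : m b \in [set u; v] by rewrite E !inE eqxx orbT.
have : u \in [set m a; m b] by rewrite -E !inE eqxx.
have : v \in [set m a; m b] by rewrite -E !inE eqxx orbT.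
have ba : e b a by rewrite /e adj_sym.
have nB : [set b; a] != [set x; y] by rewrite setUC.
rewrite !inE => /orP[]/eqP hv /orP[]/eqP hu /orP[]/eqP hb /orP[]/eqP ha;
  by [exists a, b; split=> //; congruence | exists b, a; split=> //; congruence].
Qed.

Lemma simple_contract : simple_graph T'.
Proof.
apply/forall_inP => A /imsetP[B /setD1P[nB BT] ->].
have [a [b [EB ab]]] := edge_adj sT BT; have [nab aD bD] := adj_vertices sT ab.
rewrite EB merge_set2 subUset !sub1set cards2 !imset_f // andbT eqSS eqb1.
rewrite andbT; rewrite EB in nB; apply: contra nB; rewrite /Defs.merge.
case: (eqVneq a y) => [Ea|_]; case: (eqVneq b y) => [Eb|_].
- by rewrite Ea Eb eqxx in nab.
- by move=> /eqP <-; rewrite Ea setUC.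
- by move=> /eqP ->; rewrite Eb.
by rewrite (negbTE nab).
Qed.

Definition compatible S := (x \in S) == (y \in S).

Lemma merge_compatible S a : compatible S -> (m a \in S) = (a \in S).
Proof. by rewrite /Defs.merge; case: eqVneq => // -> /eqP. Qed.

(** An edge of the contraction comes from an edge ab other than xy, and xy does
    not cross the cut of ab.  So x and y are on the same side, and the same cut
    serves in the contraction. *)
Lemma forest_contract : forest e'.
Proof.
move=> u v /adj_contractP[a [b [ab nab <- <-]]].
have [Z [aZ bZ cutZ]] := fT ab; exists Z.
have cZ : compatible Z.
  rewrite /compatible; apply: contraR nab => xyZ.
  have [xZ|xZ] := boolP (x \in Z).
    have yZ : y \notin Z by rewrite xZ eq_sym eqb_id in xyZ.
    by have [-> ->] := cutZ x y xZ yZ exy.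
  have yZ : y \in Z by move: xyZ; rewrite (negbTE xZ) eq_sym eqbF_neg negbK.
  have yx : e y x by rewrite /e adj_sym.
  by have [-> ->] := cutZ y x yZ xZ yx; rewrite setUC.
split; rewrite ?merge_compatible //.
move=> u' v' uZ vZ /adj_contractP[a' [b' [ab' _ Eu Ev]]].
rewrite -Eu merge_compatible // in uZ; rewrite -Ev merge_compatible // in vZ.
by rewrite -Eu -Ev; have [-> ->] := cutZ a' b' uZ vZ ab'.
Qed.

(** Closed subsets of S and of its image correspond to each other: a closed
    subset of S contains x exactly when it contains y, because of the edge
    xy. *)
Lemma conn_contract S : compatible S -> conn e' (S :\ y) = conn e S.
Proof.
move=> cS; have mS a : a \in S -> m a \in S :\ y.
  by move=> aS; rewrite !inE merge_neq merge_compatible.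
apply/connP/connP => -[S0 conS].
  have [z /setD1P[zy zS]] := set0Pn _ S0.
  split=> [|X XS X0 clX]; first by apply/set0Pn; exists z.
  have yx : e y x by rewrite /e adj_sym.
  have cX : compatible X.
    rewrite /compatible; apply/eqP; apply/idP/idP => [xX|yX].
      apply: (clX x) => //; rewrite -(eqP cS); exact: (subsetP XS).
    by apply: (clX y) => //; rewrite (eqP cS); exact: (subsetP XS).
  have E : X :\ y = S :\ y.
    apply: conS; first exact: setSD.
      have [c cX'] := set0Pn _ X0; apply/set0Pn; exists (m c).
      by rewrite !inE merge_neq merge_compatible.
    move=> u v /setD1P[uy uX] /setD1P[vy vS] /adj_contractP[a [b [ab _ Eu Ev]]].
    rewrite !inE vy /= -Ev merge_compatible //.
    have aX : a \in X by rewrite -merge_compatible // Eu.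
    by apply: clX ab => //; rewrite -merge_compatible // Ev.
  apply/setP => c; have [->|cy] := eqVneq c y.
    by rewrite -(eqP cX) -(eqP cS); move/setP/(_ x): E; rewrite !inE nxy.
  by move/setP/(_ c): E; rewrite !inE cy.
have [z zS] := set0Pn _ S0.
split=> [|X XS X0 clX]; first by apply/set0Pn; exists (m z); apply: mS.
pose X' := [set c in S | m c \in X].
have E : X' = S.
  apply: conS; first by apply/subsetP => c; rewrite inE => /andP[].
    have [c cX] := set0Pn _ X0; have /setD1P[cy cS'] := subsetP XS c cX.
    by apply/set0Pn; exists c; rewrite inE cS' merge_id.
  move=> a b; rewrite !inE => /andP[aS aX] bS ab; rewrite bS /=.
  have [E|nab] := eqVneq [set a; b] [set x; y].
    suff <- : m a = m b by [].
    have /set2P[] : a \in [set x; y] by rewrite -E !inE eqxx.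
      have /set2P[->->|->->] : b \in [set x; y] by rewrite -E !inE eqxx orbT.
      - by [].
      - by rewrite merge_y merge_id.
    have /set2P[->->|->->] : b \in [set x; y] by rewrite -E !inE eqxx orbT.
    - by rewrite merge_y merge_id.
    by [].
  apply: (clX (m a)) => //; first exact: mS.
  by apply/adj_contractP; exists a, b.
apply/eqP; rewrite eqEsubset XS; apply/subsetP => c /setD1P[cy cS'].
by move: cS'; rewrite -{1}E inE merge_id // => /andP[].
Qed.

Lemma connsets_contract_sum (f : {set V} -> nat) :
  \sum_(U in connsets e' (vertices T')) f U =
  \sum_(S in connsets e D | (x \in S) == (y \in S)) f (S :\ y).
Proof.
rewrite vertices_contract.
rewrite (reindex_onto (fun S => S :\ y) (fun U => if x \in U then y |: U else U)) /=.
  apply: eq_bigl => S; rewrite !inE nxy /=.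
  apply/andP/andP => [[/andP[cS SD] /eqP E]|[/andP[cS SD] xyS]].
    have xyS : compatible S.
      by move: E; case: ifP => xS E; rewrite /compatible xS -E !inE eqxx.
    rewrite -(conn_contract xyS) cS; split=> //.
    apply/subsetP => z zS; have [->//|zy] := eqVneq z y.
    by have /subsetP/(_ z) := SD; rewrite !inE zy zS => /(_ isT).
  rewrite (conn_contract xyS) cS setSD //; split=> //; apply/eqP.
  case: ifP => xS; first by rewrite setD1K // -(eqP xyS).
  by apply/setDidPl; rewrite disjoint_sym disjoints1 -(eqP xyS) xS.
move=> U; rewrite inE => /andP[_ /subsetP UD].
have yU : y \notin U by apply/negP => /UD; rewrite !inE eqxx.
case: ifP => _; first by rewrite setU1K.
by apply/setDidPl; rewrite disjoint_sym disjoints1.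
Qed.

End Contract.

(** * Path graphs *)

Section PathGraph.
Variable V : finType.
Implicit Types (T : graph V) (l : seq V) (x y u v : V) (A D : {set V}).

Lemma links_pair A l : A \in links l ->
  exists l1 u v l2, l = rcons l1 u ++ v :: l2 /\ A = [set u; v].
Proof.
elim: l => [//|x [//|y l] IH]; rewrite /= inE => /orP[/eqP->|].
  by exists [::], x, y, l.
case/IH => l1 [u [v [l2 [-> ->]]]]; exists (x :: l1), u, v, l2; split=> //.
Qed.

Lemma spans_path_rev (e : rel V) l D : spans_path e l D -> spans_path e (rev l) D.
Proof.
move=> [ul -> h]; split; first by rewrite rev_uniq.
  by apply/setP => z; rewrite !inE mem_rev.
by move=> u v; rewrite !mem_rev links_rev; apply: h.
Qed.

Lemma is_path_spans T : simple_graph T -> vertices T != set0 ->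
  is_path T <-> exists l, spans_path (adj T) l (vertices T).
Proof.
move=> sT T0; split=> [[x [p [up EV EE]]]|[[|x p] [up EV h]]].
- exists (x :: p); split=> // u v _ _.
  by rewrite /adj EE inE.
- by case/set0Pn: T0 => z; rewrite EV inE.
exists x, p; split=> //; apply/setP => A; rewrite inE.
apply/idP/idP => [AT|AL].
  have [u [v [-> uv]]] := edge_adj sT AT.
  have [_ uT vT] := adj_vertices sT uv.
  by rewrite -[pairmap _ _ _]/(links (x :: p)) -h //; move: uT vT; rewrite EV !in_set.
have [l1 [u [v [l2 [E EA]]]]] := @links_pair A (x :: p) AL.
have := h u v; rewrite /adj -EA AL => -> //.
  by rewrite E mem_cat mem_rcons mem_head.
by rewrite E mem_cat mem_head orbT.
Qed.

(** A path that uses the edge xy passes it in one of the two directions, so the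
    path or its reversal splits into two paths leading away from the edge. *)
Lemma links_split l x y : [set x; y] \in links l ->
  exists a b, l = rev (x :: a) ++ y :: b \/ rev l = rev (x :: a) ++ y :: b.
Proof.
case/links_pair => l1 [u [v [l2 [-> E]]]].
have : x \in [set u; v] by rewrite -E !inE eqxx.
have : y \in [set u; v] by rewrite -E !inE eqxx orbT.
have : u \in [set x; y] by rewrite E !inE eqxx.
have : v \in [set x; y] by rewrite E !inE eqxx orbT.
have h1 : u = x -> v = y -> exists a b, rcons l1 u ++ v :: l2 = rev (x :: a) ++ y :: b \/
   rev (rcons l1 u ++ v :: l2) = rev (x :: a) ++ y :: b.
  by move=> -> ->; exists (rev l1), l2; left; rewrite rev_cons revK.
have h2 : u = y -> v = x -> exists a b, rcons l1 u ++ v :: l2 = rev (x :: a) ++ y :: b \/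
   rev (rcons l1 u ++ v :: l2) = rev (x :: a) ++ y :: b.
  move=> -> ->; exists l2, (rev l1); right.
  by rewrite rev_cat rev_rcons -cat_rcons rev_cons.
rewrite !inE => /orP[]/eqP hv /orP[]/eqP hu /orP[]/eqP hy /orP[]/eqP hx;
  by [apply: h1; congruence | apply: h2; congruence].
Qed.
End PathGraph.

(** * The two means *)

(** Here w / n is the mean for the contraction, and a + b and c are what the
    whole tree has in addition. *)
Lemma contraction_difference (n w a b c N : rat) :
  (0 < n -> 0 < a -> 0 < b -> 0 < N -> N = n + a + b ->
  (w + c) / N - w / n - 1 / 3 =
    (n * (3 * c - N) - 3 * (a + b) * w) / (3 * n * N))%R.
Proof.
move=> n0 a0 b0 N0 E; rewrite E in N0 *; field.
by rewrite !gt_eqF.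
Qed.

Theorem corollary1p2 (V : finType) (T : graph V) (x y : V) :
  is_tree T -> [set x; y] \in edges T ->
  ((1 / 3 <= mean_subtree_order T - mean_subtree_order (contract x y T))%R /\
   ((mean_subtree_order T - mean_subtree_order (contract x y T) = 1 / 3)%R
      <-> is_path T)).
Proof.
move=> [sT T0 cT acT] exy.
have fT := acyclic_forest sT acT; have eS := @adj_sym V T.
rewrite connected_conn // in cT.
have [nxy xD yD] := adj_vertices sT exy.
have [Z cutZ] := fT x y exy; have [xZ yZ _] := cutZ.
have -> : mean_subtree_order (contract x y T) =
    ((tot_compatible (adj T) (vertices T) x y)%:R / (num_compatible (adj T) (vertices T) x y)%:R)%R.
  rewrite mean_subtree_orderE; [|exact: simple_contract|exact: forest_contract].
  by rewrite /tot_conn /num_conn !connsets_contract_sum.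
rewrite mean_subtree_orderE //.
set D := vertices T in cT xD yD *; set e := adj T in fT eS cT cutZ *.
have cA := conn_cut_restrict eS cutZ cT xD yD.
have cB := conn_cut_restrict_compl eS cutZ cT xD yD.
have [|pA hA] := conn_rooted_profile eS fT cA (x := x); first by rewrite inE xD.
have [|pB hB] := conn_rooted_profile eS fT cB (x := y); first by rewrite inE yZ.
(* The recursions, read in rat, put the two means in terms of the eight counts. *)
have := contraction_gap pA pB.
have natE (k l : nat) : k = l -> (k%:R = l%:R :> rat)%R by move=> ->.
have := natE _ _ (num_conn_edge eS cutZ exy xD yD).
have := natE _ _ (tot_conn_edge eS cutZ exy xD yD).
have := natE _ _ (num_compatible_edge eS cutZ exy xD yD).
have := natE _ _ (tot_compatible_edge eS cutZ exy xD yD).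
rewrite !(natrD, natrM).
have [a1 aN Np _ _] := pA; have [b1 bM Mq _ _] := pB.
set a : rat := (num_rooted e (D :&: Z) x)%:R%R in a1 aN *.
set p : rat := (tot_rooted e (D :&: Z) x)%:R%R in Np *.
set N : rat := (num_conn e (D :&: Z))%:R%R in aN Np *.
set W : rat := (tot_conn e (D :&: Z))%:R%R.
set b : rat := (num_rooted e (D :\: Z) y)%:R%R in b1 bM *.
set q : rat := (tot_rooted e (D :\: Z) y)%:R%R in Mq *.
set M : rat := (num_conn e (D :\: Z))%:R%R in bM Mq *.
set U : rat := (tot_conn e (D :\: Z))%:R%R.
set w : rat := (tot_compatible e D x y)%:R%R.
set n : rat := (num_compatible e D x y)%:R%R.
move=> Ew En -> ->.
have {}Ew : w = (W + U - p - q + (p * b + a * q - a * b))%R by lra.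
have {}En : n = (N + M - a - b + a * b)%R by lra.
rewrite /= -Ew -En => -[g0 gE].
have ab1 : (0 < a * b)%R by apply: mulr_gt0; lra.
have n0 : (0 < n)%R by lra.
have N0 : (0 < N + M + a * b)%R by lra.
have d0 : (0 < 3 * n * (N + M + a * b))%R by rewrite !mulr_gt0.
have diff : ((W + U + (p * b + a * q)) / (N + M + a * b) - w / n - 1 / 3 =
    (n * (3 * (a * b + p + q) - (N + M + a * b)) - 3 * (a + b) * w) /
    (3 * n * (N + M + a * b)))%R.
  rewrite -contraction_difference; [|lra..].
  by congr (_ / _ - _ - _)%R; lra.
(* Both parts are now statements about the numerator g: its sign, and its zeros. *)
split; first by rewrite -subr_ge0 diff divr_ge0 // ltW.
rewrite is_path_spans //; apply: iff_trans (_ : _ <-> rooted_gap e (D :&: Z) x = 0%R /\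
    rooted_gap e (D :\: Z) y = 0%R) _.
  rewrite -gE; split=> [E|g_0].
    move/eqP: diff; rewrite E subrr eq_sym mulf_eq0 invr_eq0 (gt_eqF d0) orbF.
    by move/eqP.
  by move/eqP: diff; rewrite g_0 mul0r subr_eq0 => /eqP.
split=> [[/hA[l lA] /hB[l' lB]]|[l lD]].
  by exists (rev (x :: l) ++ y :: l'); apply: spans_path_glue cutZ exy lA lB.
have [_ ED h] := lD.
have [|la [lb E]] := @links_split _ l x y.
  by rewrite -h //; [move: xD | move: yD]; rewrite /D ED inE.
have {lD} : spans_path e (rev (x :: la) ++ y :: lb) D.
  by case: E => <- //; apply: spans_path_rev.
case/(spans_path_unglue eS cutZ exy) => lA lB.
by split; [apply: path_rooted_gap0 cA lA | apply: path_rooted_gap0 cB lB].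
Qed.
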